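(* Let $\mu$ be a discrete growth rate and consider the nonautonomous difference equation $x(k+1)=A(k)x(k)$, $k\in\mathbb{Z}$, with $A:\mathbb{Z}\to\mathbb{R}^{d\times d}$. There exists some $m\in\{0,1,\dots,d\}$ such that $$\Sigma_{\mathrm{N}\mu\mathrm{D}}(A)=\bigcup_{i=1}^m[a_i,b_i]$$ for some $a_i,b_i\in\mathbb{R}\cup\{\pm\infty\}$ verifying $a_i\le b_i<a_{i+1}$ (an interval with an infinite endpoint is understood as a subset of $\mathbb{R}$). Moreover: (i) For each $\gamma\in\rho_{\mathrm{N}\mu\mathrm{D}}(A)$, the $\gamma$-weighted system has $\mathrm{N}\mu\mathrm{D}$ with a unique invariant projector $n\mapsto \mathrm{P}(n)$. (ii) For $\zeta,\gamma\in\rho_{\mathrm{N}\mu\mathrm{D}}(A)$, the projectors of their respective weighted systems are the same if and only if $\zeta$ and $\gamma$ lie in the same spectral gap. (iii) If $\zeta,\gamma\in\rho_{\mathrm{N}\mu\mathrm{D}}(A)$ lie in different spectral gaps and $\zeta>\gamma$, then $\mathcal{U}_\zeta\subsetneq\mathcal{U}_\gamma$ and $\mathcal{S}_\gamma\subsetneq\mathcal{S}_\zeta$. (iv) If the system $x(k+1)=A(k)x(k)$ has $(\mathrm{N}\mu,\epsilon)$-growth, the spectrum is nonempty and bounded, that is, $m\neq 0$, $a_1\neq-\infty$ and $b_m\neq+\infty$.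
   Context: Let $d\ge 1$, $A:\mathbb{Z}\to\mathbb{R}^{d\times d}$ (not assumed nonsingular) and consider the system $x(k+1)=A(k)x(k)$, $k\in\mathbb{Z}$. Evolution operator: $\Phi(k,n)=A(k-1)\cdots A(n)$ for $k>n$, $\Phi(n,n)=\mathrm{Id}$; if $A$ is nonsingular, $\Phi(k,n)=A^{-1}(k)\cdots A^{-1}(n-1)$ for $k<n$. Invariant projector: a map $\mathrm{P}:\mathbb{Z}\to\mathbb{R}^{d\times d}$ of idempotents with $A(n)\mathrm{P}(n)=\mathrm{P}(n+1)A(n)$ and such that $A(n)|_{\ker \mathrm{P}(n)}:\ker \mathrm{P}(n)\to\ker \mathrm{P}(n+1)$ is an isomorphism, for all $n\in\mathbb{Z}$. Given an invariant projector, for $k<n$ one sets $\Phi(k,n)=[\Phi(n,k)|_{\ker \mathrm{P}(k)}]^{-1}:\ker \mathrm{P}(n)\to\ker \mathrm{P}(k)$ (also when $A$ is singular). Discrete growth rate: a non-decreasing map $\mu:\mathbb{Z}\to(0,\infty)$ with $\mu(0)=1$, $\lim_{n\to+\infty}\mu(n)=+\infty$, $\lim_{n\to-\infty}\mu(n)=0$. Put $\mathrm{sgn}(n)=1,0,-1$ for $n>0$, $n=0$, $n<0$. Nonuniform $\mu$-dichotomy ($\mathrm{N}\mu\mathrm{D}$): the system admits it with invariant projector $\mathrm{P}$ if there are constants $K\ge1$, $\alpha<0$, $\beta>0$, $\theta,\nu\ge0$ with $\alpha+\theta<0$, $\beta-\nu>0$ and $$\|\Phi(k,n)\mathrm{P}(n)\|\le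 K\left(\tfrac{\mu(k)}{\mu(n)}\right)^{\alpha}\mu(n)^{\mathrm{sgn}(n)\theta}\ (k\ge n),\qquad \|\Phi(k,n)[\mathrm{Id}-\mathrm{P}(n)]\|\le K\left(\tfrac{\mu(k)}{\mu(n)}\right)^{\beta}\mu(n)^{\mathrm{sgn}(n)\nu}\ (k\le n).$$ (If $\mathrm{P}=\mathrm{Id}$ there are no $\beta,\nu$; if $\mathrm{P}=0$ there are no $\alpha,\theta$.) $\gamma$-weighted system ($\gamma\in\mathbb{R}$): $x(k+1)=A(k)\left(\frac{\mu(k+1)}{\mu(k)}\right)^{-\gamma}x(k)$, with evolution operator $\Phi_\gamma(k,n)=\left(\frac{\mu(k)}{\mu(n)}\right)^{-\gamma}\Phi(k,n)$. $\rho_{\mathrm{N}\mu\mathrm{D}}(A)$ is the set of $\gamma\in\mathbb{R}$ such that the $\gamma$-weighted system admits $\mathrm{N}\mu\mathrm{D}$, and $\Sigma_{\mathrm{N}\mu\mathrm{D}}(A)=\mathbb{R}\setminus\rho_{\mathrm{N}\mu\mathrm{D}}(A)$. A spectral gap is a connected component of $\rho_{\mathrm{N}\mu\mathrm{D}}(A)$. Stable and unstable manifolds of a system with evolution operator $\Phi$: $\mathcal{S}=\{(n,\xi)\in\mathbb{Z}\times\mathbb{R}^d:\sup_{k\in\mathbb{Z}^+}\|\Phi(k,n)\xi\|<\infty\}$ and $\mathcal{U}=\{(n,\xi)\in\mathbb{Z}\times\mathbb{R}^d:\sup_{k\in\mathbb{Z}^-}\|\Phi(k,n)\xi\|<\infty\}$.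 When $A$ is singular, in $\mathcal{S}$ only $k\ge n$ is considered, and $(n,\xi)\in\mathcal{U}$ means that there is a bounded sequence $(x(k))_{k\le n}$ with $x(n)=\xi$ and $x(k+1)=A(k)x(k)$ for $k<n$. $\mathcal{S}_\gamma,\mathcal{U}_\gamma$ denote these sets for the $\gamma$-weighted system. $(\mathrm{N}\mu,\epsilon)$-growth ($\epsilon>0$): there are $\widehat K\ge1$, $a\ge0$ with $\|\Phi(k,n)\|\le\widehat K\left(\frac{\mu(k)}{\mu(n)}\right)^{\mathrm{sgn}(k-n)a}\mu(n)^{\mathrm{sgn}(n)\epsilon}$ for all $k,n\in\mathbb{Z}$ (so $\Phi(k,n)$ is defined for all $k,n$, i.e. $A$ is nonsingular). *)

(* Defs.v *)
From mathcomp Require Import all_boot all_order all_algebra.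
From mathcomp Require Import all_classical all_reals all_analysis.

Set Implicit Arguments.
Unset Strict Implicit.
Unset Printing Implicit Defensive.

Import Order.TTheory GRing.Theory Num.Theory.
Import numFieldNormedType.Exports.

Local Open Scope classical_set_scope.
Local Open Scope ring_scope.

(* R^d is 'cV[R]_d with the norm of the library (the sup norm).  The norm of
   an operator is the induced one; the spectrum, the projectors and the
   manifolds below do not depend on the choice of the norm on R^d. *)
Definition opnorm (R : realType) (d : nat) (f : 'cV[R]_d -> 'cV[R]_d) : R :=
  sup [set `|f x| | x in [set x : 'cV[R]_d | `|x| <= 1]].

Record growth_rate (R : realType) (mu : int -> R) : Prop := GrowthRate {
  growth_rate_gt0 : forall n, 0 < mu n;
  growth_rate_ndecr : {homo mu : m n / m <= n};
  growth_rate0 : mu 0 = 1;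
  growth_rate_pinfty : mu n%:Z @[n --> \oo] --> +oo;
  growth_rate_ninfty : mu (- n%:Z) @[n --> \oo] --> (0 : R) }.

Definition nonsingular (R : realType) (d : nat) (A : int -> 'M[R]_d) : Prop :=
  forall n, A n \in unitmx.

(* evol_fwd A n j = A(n+j-1) ... A(n) *)
Fixpoint evol_fwd (R : realType) (d : nat) (A : int -> 'M[R]_d) (n : int)
    (j : nat) : 'M[R]_d :=
  if j is i.+1 then A (n + i%:Z) *m evol_fwd A n i else 1%:M.

(* evol_bwd A n j = A(n-j)^-1 ... A(n-1)^-1 *)
Fixpoint evol_bwd (R : realType) (d : nat) (A : int -> 'M[R]_d) (n : int)
    (j : nat) : 'M[R]_d :=
  if j is i.+1 then invmx (A (n - i.+1%:Z)) *m evol_bwd A n i else 1%:M.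

(* Phi(k, n).  For k < n this value is meaningful only if A is nonsingular
   (invmx is the identity map on singular matrices). *)
Definition evol (R : realType) (d : nat) (A : int -> 'M[R]_d) (k n : int) :
    'M[R]_d :=
  if n <= k then evol_fwd A n `|k - n|%N else evol_bwd A n `|n - k|%N.

Definition kerP (R : realType) (d : nat) (P : int -> 'M[R]_d) (n : int) :
    set 'cV[R]_d :=
  [set x | P n *m x = 0].

Record invariant_projector (R : realType) (d : nat) (A P : int -> 'M[R]_d) :
    Prop := InvariantProjector {
  invproj_idem : forall n, P n *m P n = P n;
  invproj_comm : forall n, A n *m P n = P (n + 1) *m A n;
  invproj_iso : forall n, set_bij (kerP P n) (kerP P (n + 1)) (mulmx (A n)) }.

(* For k <= n, Phi(k, n) : ker P(n) -> ker P(k), the inverse of the restriction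
   of Phi(n, k) to ker P(k); the value outside ker P(n) is irrelevant. *)
Definition evol_ker (R : realType) (d : nat) (A P : int -> 'M[R]_d)
    (k n : int) : 'cV[R]_d -> 'cV[R]_d :=
  'pinv_(fun=> 0) (kerP P k) (mulmx (evol A n k)).

(* When P = Id (resp. P = 0) the second (resp. first) estimate reads 0 <= _ and
   puts no constraint on beta, nu (resp. alpha, theta). *)
Definition NmuD (R : realType) (d : nat) (mu : int -> R)
    (A P : int -> 'M[R]_d) : Prop :=
  invariant_projector A P /\
  exists K alpha beta theta nu : R,
    [/\ [/\ 1 <= K, alpha < 0 & 0 < beta],
        [/\ 0 <= theta, 0 <= nu, alpha + theta < 0 & 0 < beta - nu],
        forall k n : int, n <= k ->
          opnorm (fun x => evol A k n *m (P n *m x))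
            <= K * (mu k / mu n) `^ alpha * mu n `^ ((sgz n)%:~R * theta)
      & forall k n : int, k <= n ->
          opnorm (fun x => evol_ker A P k n ((1%:M - P n) *m x))
            <= K * (mu k / mu n) `^ beta * mu n `^ ((sgz n)%:~R * nu)].

Definition weighted (R : realType) (d : nat) (mu : int -> R)
    (A : int -> 'M[R]_d) (gamma : R) : int -> 'M[R]_d :=
  fun k => (mu (k + 1) / mu k) `^ (- gamma) *: A k.

Definition resolvent (R : realType) (d : nat) (mu : int -> R)
    (A : int -> 'M[R]_d) : set R :=
  [set gamma | exists P, NmuD mu (weighted mu A gamma) P].

Definition spectrum (R : realType) (d : nat) (mu : int -> R)
    (A : int -> 'M[R]_d) : set R :=
  ~` resolvent mu A.

Definition spectral_gap (R : realType) (d : nat) (mu : int -> R)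
    (A : int -> 'M[R]_d) (G : set R) : Prop :=
  exists2 gamma, resolvent mu A gamma
    & G = connected_component (resolvent mu A) gamma.

Definition same_gap (R : realType) (d : nat) (mu : int -> R)
    (A : int -> 'M[R]_d) (zeta gamma : R) : Prop :=
  exists G, [/\ spectral_gap mu A G, G zeta & G gamma].

(* For singular A only the k >= n are considered. *)
Definition stable_manifold (R : realType) (d : nat) (A : int -> 'M[R]_d) :
    set (int * 'cV[R]_d) :=
  [set p | has_ubound [set `|evol A k p.1 *m p.2| |
     k in [set k : int | 0 <= k /\ (nonsingular A \/ p.1 <= k)]]].

Definition unstable_manifold (R : realType) (d : nat) (A : int -> 'M[R]_d) :
    set (int * 'cV[R]_d) :=
  [set p |
     (nonsingular A ->
        has_ubound [set `|evol A k p.1 *m p.2| | k in [set k : int | k <= 0]])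
     /\ (~ nonsingular A ->
        exists x : int -> 'cV[R]_d,
          [/\ x p.1 = p.2,
              forall k, k < p.1 -> x (k + 1) = A k *m x k
            & has_ubound [set `|x k| | k in [set k : int | k <= p.1]]])].

Definition Nmu_growth (R : realType) (d : nat) (mu : int -> R) (eps : R)
    (A : int -> 'M[R]_d) : Prop :=
  nonsingular A /\
  exists K a : R,
    [/\ 1 <= K, 0 <= a
      & forall k n : int,
          opnorm (mulmx (evol A k n))
            <= K * (mu k / mu n) `^ ((sgz (k - n))%:~R * a)
                 * mu n `^ ((sgz n)%:~R * eps)].

Definition ext_itv (R : realType) (a b : \bar R) : set R :=
  [set x : R | (a <= x%:E <= b)%E].

(* Main.v *)
(* Write L = ln mu.  Seen on the original system, the two estimates of the
   g-weighted dichotomy survive small changes of g; the stable one also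
   survives increasing g, the unstable one decreasing g.  For g <= h in the
   resolvent, a solution in the range of P_g grows at rate less than g, one in
   the kernel of P_h at rate more than h, whence P_g P_h = P_h P_g = P_g: this
   yields uniqueness (g = h), the order of the manifolds (which are the range
   and the kernel of the projector) and the monotonicity of the rank, with
   equal ranks only if P_g = P_h, in which case [g, h] lies in the resolvent.
   So there are at most d + 1 gaps, and a gap of rank 0 or d is unbounded below
   or above; the spectrum is thus cut into at most d closed intervals, indexed
   by the rank found just below them. *)
Require Import Defs.
From mathcomp Require Import all_boot all_order all_algebra.
From mathcomp Require Import all_classical all_reals all_analysis.
From mathcomp Require Import zify ring lra.

Set Implicit Arguments.
Unset Strict Implicit.
Unset Printing Implicit Defensive.

Import Order.TTheory GRing.Theory Num.Theory.
Import numFieldNormedType.Exports.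

Local Open Scope classical_set_scope.
Local Open Scope ring_scope.

(** * Operator norm and products of the coefficient matrices *)

Lemma norm_entry_le (R : realType) (d : nat) (x : 'cV[R]_d) (i : 'I_d) :
  `|x i 0| <= `|x|.
Proof. by rewrite [leRHS]mx_normrE (le_bigmax _ _ (i, 0)). Qed.

Lemma mulmx_bounded (R : realType) (d : nat) (M : 'M[R]_d) :
  exists2 C : R, 0 <= C & forall x : 'cV[R]_d, `|M *m x| <= C * `|x|.
Proof.
exists (\sum_i \sum_j `|M i j|) => [|x].
  by rewrite !sumr_ge0 // => i _; rewrite sumr_ge0.
have C0 : 0 <= \sum_i \sum_j `|M i j|.
  by rewrite !sumr_ge0 // => i _; rewrite sumr_ge0.
rewrite [leLHS]mx_normrE; apply/bigmax_leP; split; first by rewrite mulr_ge0.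
move=> [i j] _ /=; rewrite ord1 !mxE.
apply: (@le_trans _ _ ((\sum_j `|M i j|) * `|x|)).
  rewrite mulr_suml; apply: le_trans (ler_norm_sum _ _ _) _.
  by apply: ler_sum => k _; rewrite normrM ler_wpM2l // norm_entry_le.
rewrite ler_wpM2r // [leRHS](bigD1 i) //= lerDl sumr_ge0 // => k _.
by rewrite sumr_ge0.
Qed.

(** A real [sup] is informative only for a bounded set; the matrix [M] provides the bound, through
    [mulmx_bounded]. This is why the operators below are first exhibited as matrices. *)
Lemma opnorm_leP (R : realType) (d : nat) (f : 'cV[R]_d -> 'cV[R]_d)
    (M : 'M[R]_d) (C : R) : 0 <= C -> (forall x, f x = M *m x) ->
  opnorm f <= C <-> forall x : 'cV[R]_d, `|M *m x| <= C * `|x|.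
Proof.
move=> C0 fM; split=> [fC x|MC]; last first.
  apply: ge_sup; first by exists `|f 0|, 0 => //=; rewrite normr0.
  by move=> _ [x /= x1 <-]; rewrite fM (le_trans (MC x)) // ler_piMr.
have [D D0 MD] := mulmx_bounded M.
have [->|x0] := eqVneq x 0; first by rewrite mulmx0 !normr0 mulr0.
have nx : 0 < `|x| by rewrite normr_gt0.
rewrite -ler_pdivrMr // (le_trans _ fC) //.
apply: ub_le_sup.
  by exists D => _ [y /= y1 <-]; rewrite fM (le_trans (MD y)) // ler_piMr.
exists (`|x|^-1 *: x) => /=.
  by rewrite normrZ normfV normr_id mulVf // gt_eqF.
by rewrite fM -scalemxAr normrZ normfV normr_id mulrC.
Qed.

Lemma evol_natD (R : realType) (d : nat) (A : int -> 'M[R]_d) n (j : nat) :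
  evol A (n + j%:Z) n = evol_fwd A n j.
Proof. by rewrite /evol lerDl /= [n + _]addrC addrK. Qed.

Lemma evol_natB (R : realType) (d : nat) (A : int -> 'M[R]_d) n (j : nat) :
  evol A (n - j%:Z) n = evol_bwd A n j.
Proof.
rewrite /evol; have [|_] := boolP (n <= n - j%:Z);
  last by rewrite opprB addrC subrK.
(* [n <= n - j] holds only for [j = 0], where both products are empty. *)
have [->|j0] := eqVneq j 0%N; first by rewrite subr0 subrr.
by move=> H; exfalso; lia.
Qed.

Lemma evol_fwd_unit (R : realType) (d : nat) (A : int -> 'M[R]_d) n j :
  nonsingular A -> evol_fwd A n j \in unitmx.
Proof. by move=> nA; elim: j => [|j IH] /=;
  rewrite ?unitmx1 // unitmx_mul nA. Qed.

Lemma evol_fwdS (R : realType) (d : nat) (A : int -> 'M[R]_d) n j :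
  evol_fwd A n j.+1 = evol_fwd A (n + 1) j *m A n.
Proof.
elim: j => [|j IH]; first by rewrite /= mul1mx mulmx1 addr0.
by rewrite [LHS]/= -/(evol_fwd A n j.+1) IH /= -mulmxA -addrA -intS.
Qed.

Lemma evol_fwd_bwd (R : realType) (d : nat) (A : int -> 'M[R]_d) n j :
  nonsingular A -> evol_fwd A (n - j%:Z) j *m evol_bwd A n j = 1%:M.
Proof.
move=> nA; elim: j => [|j IH]; first by rewrite /= mulmx1.
rewrite evol_fwdS /= -!mulmxA (mulmxA (A _)) mulmxV // mul1mx.
by have -> : n - j.+1%:Z + 1 = n - j%:Z by lia.
Qed.

Lemma evol_fwd_traj (R : realType) (d : nat) (A : int -> 'M[R]_d)
    (x : int -> 'cV[R]_d) n j :
  (forall k, n - j%:Z <= k < n -> x (k + 1) = A k *m x k) ->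
  evol_fwd A (n - j%:Z) j *m x (n - j%:Z) = x n.
Proof.
elim: j => [|j IH] xA; first by rewrite /= mul1mx subr0.
rewrite evol_fwdS -mulmxA -xA; last by lia.
have -> : n - j.+1%:Z + 1 = n - j%:Z by lia.
by apply: IH => k hk; apply: xA; lia.
Qed.

(** * Invariant projectors and their rank *)

Section InvariantProjector.
Variables (R : realType) (d : nat) (A P : int -> 'M[R]_d).
Hypothesis AP : invariant_projector A P.

Lemma evol_fwd_comm n j :
  evol_fwd A n j *m P n = P (n + j%:Z) *m evol_fwd A n j.
Proof.
elim: j => [|j IH] /=; first by rewrite mul1mx mulmx1 addr0.
rewrite -mulmxA IH !mulmxA (invproj_comm AP).
by rewrite -addrA [j%:Z + 1]addrC -intS.
Qed.

Lemma evol_fwd_ker_bij n j :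
  set_bij (kerP P n) (kerP P (n + j%:Z)) (mulmx (evol_fwd A n j)).
Proof.
elim: j => [|j IH] /=.
  rewrite addr0; have -> : mulmx (1%:M : 'M[R]_d) = @id 'cV[R]_d.
    by apply/funext => x; rewrite mul1mx.
  by split=> [x //|x y _ _ //|x Px]; exists x.
have -> : n + j.+1%:Z = n + j%:Z + 1 by lia.
have -> : mulmx (A (n + j%:Z) *m evol_fwd A n j) =
    mulmx (A (n + j%:Z)) \o mulmx (evol_fwd A n j) :> ('cV[R]_d -> _).
  by apply/funext => x /=; rewrite mulmxA.
exact: set_bij_comp IH (invproj_iso AP _).
Qed.

Lemma evol_fwd_ker_inj n j (x y : 'cV[R]_d) : P n *m x = 0 -> P n *m y = 0 ->
  evol_fwd A n j *m x = evol_fwd A n j *m y -> x = y.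
Proof.
move=> Px Py Exy; have [_ inj _] := evol_fwd_ker_bij n j.
exact: (inj _ _ (mem_set Px) (mem_set Py) Exy).
Qed.

Lemma evol_fwd_ker_surj n j (y : 'cV[R]_d) : P (n + j%:Z) *m y = 0 ->
  exists2 x : 'cV[R]_d, P n *m x = 0 & evol_fwd A n j *m x = y.
Proof.
by move=> Py; have [_ _ +] := evol_fwd_ker_bij n j => /(_ y Py)[x Px <-];
  exists x.
Qed.

Lemma invproj_compl n (x : 'cV[R]_d) : P n *m ((1%:M - P n) *m x) = 0.
Proof. by rewrite mulmxA mulmxBr mulmx1 (invproj_idem AP) subrr mul0mx. Qed.

Lemma kerP_compl n (x : 'cV[R]_d) : P n *m x = 0 -> (1%:M - P n) *m x = x.
Proof. by move=> Px; rewrite mulmxBl mul1mx Px subr0. Qed.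

(** The inverse along the kernels, composed with the complementary projector, is linear: its columns
    are the preimages of the projected basis vectors. [M] represents [evol_ker] for [opnorm_leP],
    and the last identity serves to compare ranks. *)
Lemma evol_ker_mx n j : exists M : 'M[R]_d,
  [/\ P n *m M = 0, evol_fwd A n j *m M = 1%:M - P (n + j%:Z)
    & M *m evol_fwd A n j *m (1%:M - P n) = 1%:M - P n].
Proof.
have sol (i : 'I_d) : exists x : 'cV[R]_d, P n *m x = 0 /\
    evol_fwd A n j *m x = (1%:M - P (n + j%:Z)) *m delta_mx i 0.
  have [x ? ?] := evol_fwd_ker_surj (invproj_compl (n + j%:Z) (delta_mx i 0)).
  by exists x.
have [x xP] := choice sol.
pose M : 'M[R]_d := \matrix_(i, k) x k i 0.
have colM k : col k M = x k by apply/colP => i; rewrite !mxE.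
have PM : P n *m M = 0.
  apply/matrixP => i k; have [+ _] := xP k.
  by rewrite -colM colE mulmxA -colE => /colP/(_ i); rewrite !mxE.
have EM : evol_fwd A n j *m M = 1%:M - P (n + j%:Z).
  apply/matrixP => i k; have [_] := xP k.
  by rewrite -colM colE mulmxA -!colE => /colP/(_ i); rewrite !mxE.
exists M; split=> //.
apply/matrixP => i k.
suff /colP/(_ i) : col k (M *m evol_fwd A n j *m (1%:M - P n)) =
    col k (1%:M - P n) by rewrite !mxE.
rewrite !colE; apply: (@evol_fwd_ker_inj n j).
- by rewrite !mulmxA PM !mul0mx.
- exact: invproj_compl.
- rewrite !mulmxA EM; congr (_ *m _).
  rewrite -mulmxA mulmxBr mulmx1 evol_fwd_comm mulmxBl mul1mx mulmxBr.
  by rewrite !mulmxA (invproj_idem AP) subrr subr0.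
Qed.

Lemma mxrank_compl n : (\rank (P n) + \rank (1%:M - P n)%R = d)%N.
Proof.
apply/eqP; rewrite eqn_leq; apply/andP; split.
  by apply: mulmx0_rank_max; rewrite mulmxBr mulmx1 (invproj_idem AP) subrr.
rewrite -[leqLHS](@mxrank1 R) -[X in (\rank X <= _)%N](subrKC (P n)).
exact: mxrank_add.
Qed.

(** [A] may lose rank on the range of [P], but it is an isomorphism between the kernels. So the
    ranks of [1 - P] are compared, and those of [P] follow by complement. *)
Lemma mxrank_invprojD n j : \rank (P (n + j%:Z)) = \rank (P n).
Proof.
have [M [PM EM ME]] := evol_ker_mx n j.
have EB : evol_fwd A n j *m (1%:M - P n) =
    (1%:M - P (n + j%:Z)) *m evol_fwd A n j.
  by rewrite mulmxBr mulmx1 evol_fwd_comm mulmxBl mul1mx.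
have Mn : M = (1%:M - P n) *m M by rewrite mulmxBl mul1mx PM subr0.
suff rB : \rank (1%:M - P (n + j%:Z)) = \rank (1%:M - P n).
  by apply/eqP; rewrite -(eqn_add2r (\rank (1%:M - P n)%R)) -{1}rB
    !mxrank_compl.
apply/eqP; rewrite eqn_leq; apply/andP; split.
  rewrite -EM {1}Mn.
  exact: leq_trans (mxrankM_maxr _ _) (mxrankM_maxl _ _).
rewrite -[X in (\rank X <= _)%N]ME -mulmxA EB.
exact: leq_trans (mxrankM_maxr _ _) (mxrankM_maxl _ _).
Qed.

Lemma mxrank_invproj n : \rank (P n) = \rank (P 0).
Proof.
case: (intP n) => [//|j|j]; first by have := mxrank_invprojD 0 j.+1;
  rewrite add0r.
by have := mxrank_invprojD (- j.+1%:Z) j.+1; rewrite addNr.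
Qed.

End InvariantProjector.

(** * Logarithm of the growth rate *)

Definition lograte (R : realType) (mu : int -> R) (k : int) : R := ln (mu k).

Section GrowthRate.
Variables (R : realType) (mu : int -> R).
Hypothesis hmu : growth_rate mu.
Local Notation L := (lograte mu).

Lemma lograte_homo : {homo L : m n / m <= n}.
Proof.
move=> m n mn; rewrite /lograte ler_ln ?posrE ?growth_rate_gt0 //.
exact: growth_rate_ndecr.
Qed.

Lemma lograte0 : L 0 = 0. Proof. by rewrite /lograte growth_rate0 // ln1. Qed.

Lemma mu_powR k a : mu k `^ a = expR (a * L k).
Proof. by rewrite /powR gt_eqF // growth_rate_gt0. Qed.

Lemma ratio_powR k n a : (mu k / mu n) `^ a = expR (a * (L k - L n)).
Proof.
have m0 i : mu i \is Num.pos by rewrite posrE growth_rate_gt0.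
by rewrite /powR gt_eqF ?divr_gt0 ?growth_rate_gt0 // ln_div.
Qed.

(** As [mu 0 = 1] and [mu] is monotone, [L n] is nonnegative for [n > 0] and nonpositive for
    [n < 0]; the sign in the exponent thus amounts to an absolute value. *)
Lemma sgz_powR n a : mu n `^ ((sgz n)%:~R * a) = expR (a * `|L n|).
Proof.
rewrite mu_powR; congr expR; have [->|n0|n0] := sgzP n.
- by rewrite lograte0 normr0 !mulr0.
- by rewrite mul1r ger0_norm // -lograte0 lograte_homo // ltW.
- by rewrite mulN1r ler0_norm ?mulNr ?mulrN // -lograte0 lograte_homo // ltW.
Qed.

(** The sign of the chosen time is recorded so that the absolute value in the nonuniform factor can
    be removed there. *)
Lemma lograte_pinfty n (T : R) : exists2 j : nat, 0 <= n + j%:Z & T <= L (n +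
    j%:Z).
Proof.
have [N _ HN] : \forall j \near \oo, expR T <= mu (Posz j).
  by apply: cvgry_ge; exact: growth_rate_pinfty.
have le : `|n|%:Z + N%:Z <= n + (`|n| + `|n| + N)%N%:Z by lia.
exists (`|n| + `|n| + N)%N; first by lia.
apply: le_trans (lograte_homo le); rewrite -PoszD.
have := HN (`|n| + N)%N; rewrite /= leq_addl => /(_ isT).
by rewrite -{2}(expRK T) /lograte ler_ln ?posrE ?expR_gt0 ?growth_rate_gt0.
Qed.

Lemma lograte_ninfty n (T : R) :
  exists2 j : nat, n - j%:Z <= 0 & L (n - j%:Z) <= T.
Proof.
have [N _ HN] : \forall j \near \oo, `|mu (- Posz j)| < expR T.
  by apply: cvgr0_norm_lt; [exact: growth_rate_ninfty|exact: expR_gt0].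
have le : n - (`|n| + `|n| + N)%N%:Z <= - (`|n|%:Z + N%:Z) by lia.
exists (`|n| + `|n| + N)%N; first by lia.
apply: le_trans (lograte_homo le) _; rewrite -PoszD.
have := HN (`|n| + N)%N; rewrite /= leq_addl => /(_ isT).
rewrite gtr0_norm ?growth_rate_gt0 // => /ltW.
by rewrite -{2}(expRK T) /lograte ler_ln ?posrE ?expR_gt0 ?growth_rate_gt0.
Qed.

End GrowthRate.

(** * Decay argument and logarithmic form of the dichotomy *)

(** A positive [y] would violate the bound as soon as [t] exceeds [(a - ln (y / C)) / b]. The
    comparisons of growth rates below end here, [t] being [L] at late times or [- L] at early
    ones. *)
Lemma le_expR_decay (R : realType) (y C a b : R) : 0 <= C -> 0 < b ->
  (forall T, exists2 t, T <= t & y <= C * expR (a - b * t)) -> y <= 0.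
Proof.
move=> C0 b0 H; rewrite leNgt; apply/negP => y0.
have C1 : 0 < C.
  rewrite lt_neqAle C0 andbT eq_sym; apply/eqP => C0'.
  have [t _] := H 0; rewrite C0' mul0r => y1; lra.
have [t Tt yt] := H ((a - ln (y / C)) / b + 1).
have : a - b * t < ln (y / C).
  have := Tt; rewrite -lerBrDr ler_pdivrMr // => ?; nra.
rewrite -ltr_expR lnK ?posrE ?divr_gt0 // ltr_pdivlMr // mulrC => ?; lra.
Qed.

(* Both estimates are written with [L = ln mu], for the solutions of the
   [g]-weighted system seen as solutions of the original one: [expR] of
   [(alpha + g) * (L k - L n)] is [(mu k / mu n)^(alpha + g)]. *)
Definition stable_est (R : realType) (d : nat) (L : int -> R)
    (A P : int -> 'M[R]_d) (g : R) : Prop :=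
  exists K alpha theta : R,
    [/\ 0 <= K, alpha < 0, 0 <= theta, alpha + theta < 0
      & forall n (j : nat) (x : 'cV[R]_d),
          `|evol_fwd A n j *m (P n *m x)|
            <= K * expR ((alpha + g) * (L (n + j%:Z) - L n) + theta * `|L n|)
               * `|x| ].

Definition unstable_est (R : realType) (d : nat) (L : int -> R)
    (A P : int -> 'M[R]_d) (g : R) : Prop :=
  exists K beta nu : R,
    [/\ 0 <= K, 0 < beta, 0 <= nu, 0 < beta - nu
      & forall n (j : nat) (x y : 'cV[R]_d), P n *m y = 0 ->
          evol_fwd A n j *m y = (1%:M - P (n + j%:Z)) *m x ->
          `|y| <= K * expR ((beta + g) * (L n - L (n + j%:Z))
                            + nu * `|L (n + j%:Z)|) * `|x| ].

Definition dich_proj (R : realType) (d : nat) (L : int -> R)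
    (A P : int -> 'M[R]_d) (g : R) : Prop :=
  [/\ invariant_projector A P, stable_est L A P g & unstable_est L A P g].

Lemma int_geP (n k : int) : n <= k -> exists j : nat, k = n + j%:Z.
Proof. by move=> nk; exists `|k - n|%N; lia. Qed.

(** The preimage picked by the partial inverse is forced by injectivity on [kerP P n], and [M *m x]
    is one. *)
Lemma evol_ker_mulmx (R : realType) (d : nat) (B P : int -> 'M[R]_d) n j
    (M : 'M[R]_d) : invariant_projector B P -> P n *m M = 0 ->
  evol_fwd B n j *m M = 1%:M - P (n + j%:Z) ->
  forall x, evol_ker B P n (n + j%:Z) ((1%:M - P (n + j%:Z)) *m x) = M *m x.
Proof.
move=> BP PM EM x; rewrite /evol_ker evol_natD -EM -mulmxA.
have [_ inj _] := evol_fwd_ker_bij BP n j.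
by rewrite pinvKV // inE /kerP /= mulmxA PM mul0mx.
Qed.

(** The bound on [evol_ker] becomes a bound on every [y] in the kernel with prescribed image, which
    avoids partial inverses from here on. *)
Lemma NmuD_dich_proj (R : realType) (d : nat) (mu : int -> R)
    (B P : int -> 'M[R]_d) : growth_rate mu ->
  NmuD mu B P <-> dich_proj (lograte mu) B P 0.
Proof.
move=> hmu; split.
  case=> BP [K [a [b [t [v [[K1 a0 b0] [t0 v0 at0 bv0] Hs Hu]]]]]].
  have K0 : 0 <= K by lra.
  split=> //.
    exists K, a, t; split=> // n j x; rewrite mulmxA.
    have Cge0 : 0 <= K * expR ((a + 0) * (lograte mu (n + j%:Z) - lograte mu n)
        + t * `|lograte mu n|) by rewrite mulr_ge0 ?expR_ge0.
    apply: (opnorm_leP (f := fun x => evol B (n + j%:Z) n *m (P n *m x))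
              Cge0 _).1.
      by move=> y; rewrite evol_natD mulmxA.
    rewrite addr0 expRD mulrA.
    by rewrite -ratio_powR // -sgz_powR // Hs // lerDl.
  exists K, b, v; split=> // n j x y Py Ey.
  have Cge0 : 0 <= K * expR ((b + 0) * (lograte mu n - lograte mu (n + j%:Z))
        + v * `|lograte mu (n + j%:Z)|) by rewrite mulr_ge0 ?expR_ge0.
  have [M [PM EM _]] := evol_ker_mx BP n j.
  have -> : y = M *m x.
    apply: (evol_fwd_ker_inj BP Py (j := j)); first by rewrite mulmxA PM mul0mx.
    by rewrite Ey mulmxA EM.
  move: x {Ey}; apply/(opnorm_leP Cge0 (evol_ker_mulmx BP PM EM)).
  rewrite addr0 expRD mulrA.
  by rewrite -ratio_powR // -sgz_powR // Hu // lerDl.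
case=> BP [K [a [t [K0 a0 t0 at0 Hs]]]] [K' [b [v [K'0 b0 v0 bv0 Hu]]]].
(* [NmuD] asks for one constant, at least 1, in both estimates, while [K] and [K'] are only
   nonnegative. *)
split=> //; exists (1 + K + K'), a, b, t, v; split=> //.
- by split=> //; lra.
- move=> k n /int_geP [j ->].
  rewrite ratio_powR // sgz_powR // -mulrA -expRD.
  apply/(opnorm_leP (M := evol_fwd B n j *m P n)).
  + by rewrite mulr_ge0 ?expR_ge0; lra.
  + by move=> x; rewrite evol_natD mulmxA.
  + move=> x; rewrite -mulmxA; have := Hs n j x; rewrite addr0 => H.
    apply: le_trans H _.
    by rewrite ler_wpM2r // ler_wpM2r ?expR_ge0 //; lra.
- move=> n k /int_geP [j ->].
  rewrite ratio_powR // sgz_powR // -mulrA -expRD.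
  have [M [PM EM _]] := evol_ker_mx BP n j.
  apply/(opnorm_leP _ (evol_ker_mulmx BP PM EM)).
  + by rewrite mulr_ge0 ?expR_ge0; lra.
  + move=> x; have := Hu n j x (M *m x); rewrite !mulmxA PM mul0mx EM addr0.
    move=> /(_ erefl erefl) H; apply: le_trans H _.
    by rewrite ler_wpM2r // ler_wpM2r ?expR_ge0 //; lra.
Qed.

Lemma invariant_projectorZ (R : realType) (d : nat) (c : int -> R)
    (A P : int -> 'M[R]_d) : (forall k, c k != 0) ->
  invariant_projector A P -> invariant_projector (fun k => c k *: A k) P.
Proof.
move=> c0 AP; split; first exact: invproj_idem AP.
  by move=> n; rewrite -scalemxAl (invproj_comm AP) scalemxAr.
move=> n; have [homo inj surj] := invproj_iso AP n; split.
- by move=> x /homo; rewrite /kerP /= -scalemxAl -scalemxAr => ->;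
  rewrite scaler0.
- move=> x y xP yP; rewrite -!scalemxAl => /(scalerI (c0 n)); exact: inj.
- move=> y Py; have [x Px xy] := surj y Py.
  exists ((c n)^-1 *: x).
    by rewrite /kerP /= -scalemxAr Px scaler0.
  by rewrite -scalemxAl -scalemxAr scalerA mulfV // scale1r.
Qed.

(** * Weighted systems *)

Section Weighted.
Variables (R : realType) (d : nat) (mu : int -> R).
Hypothesis hmu : growth_rate mu.
Local Notation L := (lograte mu).

Lemma weightedE (A : int -> 'M[R]_d) g k :
  weighted mu A g k = expR (- g * (L (k + 1) - L k)) *: A k.
Proof. by rewrite /weighted ratio_powR. Qed.

Lemma weighted_fwd (A : int -> 'M[R]_d) g n j :
  evol_fwd (weighted mu A g) n j =
    expR (- g * (L (n + j%:Z) - L n)) *: evol_fwd A n j.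
Proof.
elim: j => [|j IH] /=; first by rewrite addr0 subrr mulr0 expR0 scale1r.
rewrite IH weightedE -scalemxAl -scalemxAr scalerA -expRD.
have -> : n + j.+1%:Z = n + j%:Z + 1 by lia.
by congr (expR _ *: _); ring.
Qed.

Lemma weightedD (A : int -> 'M[R]_d) g h :
  weighted mu (weighted mu A g) h = weighted mu A (g + h).
Proof.
apply/funext => k; rewrite !weightedE scalerA -expRD.
by congr (expR _ *: _); ring.
Qed.

Lemma weighted0 (A : int -> 'M[R]_d) : weighted mu A 0 = A.
Proof. by apply/funext => k; rewrite weightedE oppr0 mul0r expR0 scale1r. Qed.

Lemma invariant_projector_weighted (A P : int -> 'M[R]_d) g :
  invariant_projector A P -> invariant_projector (weighted mu A g) P.
Proof.
move=> AP; rewrite (_ : weighted mu A g =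
  fun k => expR (- g * (L (k + 1) - L k)) *: A k).
  by apply: invariant_projectorZ => // k; rewrite gt_eqF ?expR_gt0.
by apply/funext => k; rewrite weightedE.
Qed.

Lemma stable_est_weighted (A P : int -> 'M[R]_d) g h :
  stable_est L A P (g + h) -> stable_est L (weighted mu A g) P h.
Proof.
move=> [K [a [t [K0 a0 t0 at0 H]]]]; exists K, a, t; split=> // n j x.
rewrite weighted_fwd -scalemxAl normrZ gtr0_norm ?expR_gt0 //.
set D := L (n + j%:Z) - L n.
have -> : (a + h) * D + t * `|L n| = - g * D + ((a + (g + h)) * D + t * `|L n|).
  by ring.
by rewrite expRD mulrCA -mulrA ler_pM2l ?expR_gt0 // H.
Qed.

Lemma unstable_est_weighted (A P : int -> 'M[R]_d) g h :
  unstable_est L A P (g + h) -> unstable_est L (weighted mu A g) P h.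
Proof.
move=> [K [b [v [K0 b0 v0 bv0 H]]]]; exists K, b, v; split=> // n j x y Py.
rewrite weighted_fwd -scalemxAl => Ey.
set D := L (n + j%:Z) - L n in Ey *.
(* The weight is moved from the evolution to the datum [x], to which the original estimate then
   applies. *)
have /(H n j _ y Py) : evol_fwd A n j *m y =
    (1%:M - P (n + j%:Z)) *m (expR (g * D) *: x).
  rewrite -scalemxAr -Ey scalerA -expRD mulNr subrr expR0 scale1r //.
rewrite normrZ gtr0_norm ?expR_gt0 // => /le_trans; apply.
rewrite mulrA ler_wpM2r // -mulrA -expRD ler_wpM2l // ler_expR /D; lra.
Qed.

Lemma dich_proj_weighted (A P : int -> 'M[R]_d) g h :
  dich_proj L (weighted mu A g) P h <-> dich_proj L A P (g + h).
Proof.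
(* Weighting by [- g] undoes weighting by [g], so one implication gives both. *)
suff H B u w : dich_proj L B P (u + w) -> dich_proj L (weighted mu B u) P w.
  split; last exact: H.
  rewrite -{1}(addKr g h) => /H.
  by rewrite weightedD // subrr weighted0.
case=> BP Bs Bu; split.
- exact: invariant_projector_weighted.
- exact: stable_est_weighted.
- exact: unstable_est_weighted.
Qed.

Lemma NmuD_weighted (A P : int -> 'M[R]_d) g :
  NmuD mu (weighted mu A g) P <-> dich_proj L A P g.
Proof.
by rewrite NmuD_dich_proj // -{2}(addr0 g); exact: dich_proj_weighted.
Qed.

End Weighted.

Lemma mulmx_colP (R : realType) (d : nat) (M N : 'M[R]_d) :
  (forall x : 'cV[R]_d, M *m x = N *m x) -> M = N.
Proof.
move=> MN; apply/matrixP => i k.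
by have /colP/(_ i) := MN (delta_mx k 0); rewrite -!colE !mxE.
Qed.

(** * Order between dichotomy projectors *)

Section Dichotomy.
Variables (R : realType) (d : nat) (mu : int -> R) (A : int -> 'M[R]_d).
Hypothesis hmu : growth_rate mu.
Local Notation L := (lograte mu).

Lemma stable_est_le P g h : g <= h -> stable_est L A P g -> stable_est L A P h.
Proof.
move=> gh [K [a [t [K0 a0 t0 at0 H]]]]; exists K, a, t; split=> // n j x.
apply: le_trans (H n j x) _; rewrite ler_wpM2r // ler_wpM2l // ler_expR.
have := lograte_homo hmu (_ : n <= n + j%:Z); rewrite lerDl => /(_ isT) ?.
by rewrite lerD2r ler_wpM2r ?subr_ge0 // lerD2l.
Qed.

Lemma stable_est_open P g : stable_est L A P g ->
  exists2 e, 0 < e & stable_est L A P (g - e).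
Proof.
move=> [K [a [t [K0 a0 t0 at0 H]]]].
(* The rate [a] is raised by half of the slack [- (a + t)] and [g] is lowered by as much: [a + g] is
   unchanged and [a + t] stays negative. *)
exists (- (a + t) / 2); first by lra.
exists K, (a - (a + t) / 2), t; split=> //; [by lra..|] => n j x.
apply: le_trans (H n j x) _; rewrite ler_wpM2r // ler_wpM2l // ler_expR.
by rewrite lerD2r le_eqVlt; apply/orP; left; apply/eqP; field.
Qed.

Lemma unstable_est_ge P g h :
  h <= g -> unstable_est L A P g -> unstable_est L A P h.
Proof.
move=> hg [K [b [v [K0 b0 v0 bv0 H]]]]; exists K, b, v;
  split=> // n j x y Py Ey.
apply: le_trans (H n j x y Py Ey) _; rewrite ler_wpM2r // ler_wpM2l // ler_expR.
have := lograte_homo hmu (_ : n <= n + j%:Z); rewrite lerDl => /(_ isT) ?.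
by rewrite lerD2r ler_wnM2r ?subr_le0 // lerD2l.
Qed.

Lemma unstable_est_open P g : unstable_est L A P g ->
  exists2 e, 0 < e & unstable_est L A P (g + e).
Proof.
move=> [K [b [v [K0 b0 v0 bv0 H]]]].
(* Symmetrically, [b] cedes half of the slack [b - v] to [g]. *)
exists ((b - v) / 2); first by lra.
exists K, (b - (b - v) / 2), v; split=> //; [by lra..|] => n j x y Py Ey.
apply: le_trans (H n j x y Py Ey) _; rewrite ler_wpM2r // ler_wpM2l // ler_expR.
by rewrite lerD2r le_eqVlt; apply/orP; left; apply/eqP; field.
Qed.

(** The stable estimate is inherited from the lower end, the unstable one from the upper end. *)
Lemma dich_proj_between P g h k : g <= k <= h ->
  dich_proj L A P g -> dich_proj L A P h -> dich_proj L A P k.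
Proof.
case/andP=> gk kh [AP Ps _] [_ _ Pu]; split=> //.
- exact: stable_est_le Ps.
- exact: unstable_est_ge Pu.
Qed.

Lemma dich_proj_open P g : dich_proj L A P g ->
  exists2 e, 0 < e & forall k, g - e <= k <= g + e -> dich_proj L A P k.
Proof.
case=> AP /stable_est_open[e e0 Ps] /unstable_est_open[f f0 Pu].
exists (Num.min e f); first by rewrite lt_min e0.
move=> k /andP[ek kf]; split=> //.
- by apply: stable_est_le Ps; rewrite (le_trans _ ek) // lerD2l lerN2 ge_min
  lexx.
- by apply: unstable_est_ge Pu;
  rewrite (le_trans kf) // lerD2l ge_min lexx orbT.
Qed.

(* A solution starting in the range of [P] grows at rate less than [g], one
   starting in the kernel of [Q] at rate more than [h >= g], forward in time;
   the reverse holds backward in time. *)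
Lemma range_subset P Q g h : g <= h -> invariant_projector A Q ->
  stable_est L A P g -> unstable_est L A Q h ->
  forall n, Q n *m P n = P n.
Proof.
move=> gh AQ [K [a [t [K0 a0 t0 at0 Hs]]]] [K' [b [v [K'0 b0 v0 bv0 Hu]]]] n.
apply/mulmx_colP => x.
suff : `|(1%:M - Q n) *m (P n *m x)| <= 0.
  rewrite normr_le0 mulmxBl mul1mx subr_eq0 -mulmxA.
  by move/eqP <-.
set y := _ *m (P n *m x).
(* [a'] and [b'] collect the exponents of both estimates at a time where [L] is nonnegative; [b'] is
   positive because [b - v > 0], [g <= h] and [a < 0]. *)
pose C := K' * K * `|x|; pose b' := b - v + (h - g) - a.
pose a' := (b + h - a - g) * L n + t * `|L n|.
apply: (@le_expR_decay _ _ C a' b').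
- by rewrite !mulr_ge0.
- by rewrite /b'; lra.
move=> T; have [j j0 Tj] := lograte_pinfty hmu n T; exists (L (n + j%:Z)) => //.
have L0 : 0 <= L (n + j%:Z) by rewrite -(lograte0 hmu) lograte_homo.
have Ey : evol_fwd A n j *m y =
    (1%:M - Q (n + j%:Z)) *m (evol_fwd A n j *m (P n *m x)).
  rewrite /y !(mulmxA _ _ (P n *m x)) mulmxBr mulmx1 (evol_fwd_comm AQ).
  by rewrite [(1%:M - _) *m evol_fwd _ _ _]mulmxBl mul1mx.
have := Hu n j _ y (invproj_compl AQ n _) Ey.
rewrite ger0_norm // => /le_trans; apply.
have H := Hs n j x.
apply: (@le_trans _ _ (K' * expR ((b + h) * (L n - L (n + j%:Z)) +
  v * L (n + j%:Z)) * (K * expR ((a + g) * (L (n + j%:Z) - L n) + t * `|L n|)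
               * `|x|))).
  by rewrite ler_wpM2l // mulr_ge0 ?expR_ge0.
rewrite le_eqVlt; apply/orP; left; apply/eqP.
rewrite (_ : a' - b' * L (n + j%:Z) =
  ((b + h) * (L n - L (n + j%:Z)) + v * L (n + j%:Z)) +
  ((a + g) * (L (n + j%:Z) - L n) + t * `|L n|)).
  by rewrite [in RHS]expRD /C; ring.
by rewrite /a' /b'; ring.
Qed.

(** A vector of the kernel of [Q] is followed into its past along that kernel, where the unstable
    estimate bounds it; the stable estimate from there up to time [n] then forces its [P] part to
    vanish. *)
Lemma kernel_subset P Q g h : g <= h -> invariant_projector A P ->
  invariant_projector A Q -> stable_est L A P g -> unstable_est L A Q h ->
  forall n, P n *m Q n = P n.
Proof.
move=> gh AP AQ [K [a [t [K0 a0 t0 at0 Hs]]]] [K' [b [v [K'0 b0 v0 bv0 Hu]]]] n.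
apply/mulmx_colP => x; apply/esym.
suff : `|P n *m ((1%:M - Q n) *m x)| <= 0.
  by rewrite normr_le0 mulmxA mulmxBr mulmx1 mulmxBl subr_eq0 => /eqP.
set y := (1%:M - Q n) *m x.
have Qy : Q n *m y = 0 by rewrite (invproj_compl AQ).
pose C := K * K' * `|y|; pose b' := b + (h - g) - (a + t).
pose a' := (a + g - b - h) * L n + v * `|L n|.
apply: (@le_expR_decay _ _ C a' b').
- by rewrite !mulr_ge0.
- by rewrite /b'; lra.
move=> T; have [j j0 Tj] := lograte_ninfty hmu n (- T).
exists (- L (n - j%:Z)); first by lra.
have L0 : L (n - j%:Z) <= 0 by rewrite -(lograte0 hmu) lograte_homo.
(* A past exists even for singular [A], which is onto between the kernels of [Q]. *)
have [w Qw Ew] : exists2 w : 'cV_d, Q (n - j%:Z) *m w = 0 &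
    evol_fwd A (n - j%:Z) j *m w = y.
  by apply: evol_fwd_ker_surj => //; rewrite subrK.
have H1 := Hs (n - j%:Z) j w.
have := Hu (n - j%:Z) j y w Qw; rewrite subrK kerP_compl // => /(_ Ew) H2.
have -> : P n *m y = evol_fwd A (n - j%:Z) j *m (P (n - j%:Z) *m w).
  by rewrite -Ew !mulmxA (evol_fwd_comm AP) subrK.
apply: le_trans H1 _; rewrite subrK ler0_norm //.
apply: (@le_trans _ _ (K * expR ((a + g) * (L n - L (n - j%:Z)) +
   t * - L (n - j%:Z)) * (K' * expR ((b + h) * (L (n - j%:Z) - L n) +
       v * `|L n|) * `|y|))).
  by rewrite ler_wpM2l // mulr_ge0 ?expR_ge0.
rewrite le_eqVlt; apply/orP; left; apply/eqP.
rewrite (_ : a' - b' * - L (n - j%:Z) =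
  ((a + g) * (L n - L (n - j%:Z)) + t * - L (n - j%:Z)) +
  ((b + h) * (L (n - j%:Z) - L n) + v * `|L n|)).
  by rewrite [in RHS]expRD /C; ring.
by rewrite /a' /b'; ring.
Qed.

Lemma dich_proj_le P Q g h : g <= h ->
  dich_proj L A P g -> dich_proj L A Q h ->
  forall n, Q n *m P n = P n /\ P n *m Q n = P n.
Proof.
move=> gh [AP Ps _] [AQ _ Qu] n; split.
- exact: range_subset gh AQ Ps Qu n.
- exact: kernel_subset gh AP AQ Ps Qu n.
Qed.

Lemma dich_proj_uniq P Q g : dich_proj L A P g -> dich_proj L A Q g -> P = Q.
Proof.
move=> DP DQ; apply/funext => n.
have [<- _] := dich_proj_le (lexx g) DP DQ n.
by have [_] := dich_proj_le (lexx g) DQ DP n.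
Qed.

Lemma dich_proj_rank_le P Q g h : g <= h ->
  dich_proj L A P g -> dich_proj L A Q h -> (\rank (P 0) <= \rank (Q 0))%N.
Proof.
move=> gh DP DQ; have [<- _] := dich_proj_le gh DP DQ 0.
exact: mxrankM_maxl.
Qed.

(** [P = P Q] places the row space of [P n] in that of [Q n]; equal ranks give [Q n = D *m P n],
    whence [Q P = Q], while also [Q P = P]. *)
Lemma dich_proj_rank_eq P Q g h : g <= h ->
  dich_proj L A P g -> dich_proj L A Q h -> \rank (P 0) = \rank (Q 0) -> P = Q.
Proof.
move=> gh DP DQ rPQ; apply/funext => n.
have [QP PQ] := dich_proj_le gh DP DQ n.
have [AP _ _] := DP; have [AQ _ _] := DQ.
have sPQ : (P n <= Q n)%MS by rewrite -PQ submxMl.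
have : (Q n <= P n)%MS.
  by rewrite -(geq_leqif (mxrank_leqif_sup sPQ)) (mxrank_invproj AP)
    (mxrank_invproj AQ) rPQ.
case/submxP => D QD.
by rewrite -QP QD -mulmxA (invproj_idem AP).
Qed.

(** Rank 0 means [P = 0]: the stable estimate then holds with constant 0, and the unstable one
    passes to smaller rates. *)
Lemma dich_proj_rank0 P g h : h <= g ->
  dich_proj L A P g -> \rank (P 0) = 0%N -> dich_proj L A P h.
Proof.
move=> hg [AP _ Pu] P0; split=> //; last exact: unstable_est_ge Pu.
exists 0, (-1), 0; split=> //; [by lra..|] => n j x.
have -> : P n = 0 by apply/eqP; rewrite -mxrank_eq0 (mxrank_invproj AP) P0.
by rewrite mul0mx mulmx0 normr0 !mul0r.
Qed.

Lemma dich_proj_rank_full P g h : g <= h ->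
  dich_proj L A P g -> \rank (P 0) = d -> dich_proj L A P h.
Proof.
move=> gh [AP Ps _] Pd; split=> //; first exact: stable_est_le Ps.
exists 0, 1, 0; split=> //; [by lra..|] => n j x y Py _.
have uP : P n \in unitmx by rewrite -row_full_unit /row_full (mxrank_invproj
  AP) Pd.
by rewrite -(mulKmx uP y) Py mulmx0 normr0 !mul0r.
Qed.

(** A continuation argument: the projector [S] found at [sup E] works in a neighbourhood, and
    uniqueness at a nearby point of [E] identifies it with [P]. This neighbourhood reaches [h],
    since otherwise [E] would go beyond its supremum. *)
Lemma dich_proj_interval P Q g h : g <= h ->
  dich_proj L A P g -> dich_proj L A Q h ->
  (forall k, g <= k <= h -> exists S, dich_proj L A S k) -> P = Q.
Proof.
move=> gh DP DQ res.
pose E := [set k | g <= k <= h /\ dich_proj L A P k].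
have Eg : E g by split; rewrite // lexx.
have supE : has_sup E by split; [exists g|exists h => k [/andP[]]].
have gs : g <= sup E by apply: ub_le_sup => //; exact: supE.2.
have sh : sup E <= h by apply: ge_sup; [exists g|move=> k [/andP[]]].
have [S DS] := res (sup E) (introT andP (conj gs sh)).
have [e e0 De] := dich_proj_open DS.
have [k Ek ke] := sup_adherent e0 supE.
have ks : k <= sup E by apply: ub_le_sup => //; exact: supE.2.
have PS : P = S.
  have Dk : dich_proj L A S k by apply: (De); apply/andP; split; lra.
  exact: (dich_proj_uniq Ek.2 Dk).
apply: (@dich_proj_uniq _ _ h) => //; rewrite PS.
apply: (De); apply/andP; split; first by lra.
rewrite leNgt; apply/negP => seh.
have : sup E + e <= sup E.
  apply: ub_le_sup; first exact: supE.2.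
  split; first by apply/andP; split; lra.
  by rewrite PS; apply: (De); apply/andP; split; lra.
lra.
Qed.

End Dichotomy.

(** * Stable and unstable manifolds as range and kernel of the projector *)

Section Manifolds.
Variables (R : realType) (d : nat) (mu : int -> R) (B P : int -> 'M[R]_d).
Hypothesis hmu : growth_rate mu.
Local Notation L := (lograte mu).
Hypothesis DP : dich_proj L B P 0.

Let BP : invariant_projector B P. Proof. by case: DP. Qed.

(** The unstable estimate bounds the kernel part of [x] by its bounded future times a factor
    decaying at rate [b - v]. *)
Lemma stable_manifold_sub n (x : 'cV[R]_d) :
  stable_manifold B (n, x) -> P n *m x = x.
Proof.
move=> [M /= HM]; have [_ _ [K [b [v [K0 b0 v0 bv0 Hu]]]]] := DP.
apply/eqP; rewrite -subr_eq0 -normr_le0 -normrN opprB.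
pose y := (1%:M - P n) *m x; have -> : x - P n *m x = y.
  by rewrite /y mulmxBl mul1mx.
apply: (@le_expR_decay _ _ (K * `|M|) (b * L n) (b - v)) => //.
  by rewrite mulr_ge0.
move=> T; have [j j0 Tj] := lograte_pinfty hmu n T; exists (L (n + j%:Z)) => //.
have L0 : 0 <= L (n + j%:Z) by rewrite -(lograte0 hmu) lograte_homo.
have Ey : evol_fwd B n j *m y = (1%:M - P (n + j%:Z)) *m (evol_fwd B n j *m x).
  rewrite /y !(mulmxA _ _ x) mulmxBr mulmx1 (evol_fwd_comm BP).
  by rewrite [(1%:M - _) *m evol_fwd _ _ _]mulmxBl mul1mx.
have := Hu n j _ y (invproj_compl BP n _) Ey.
rewrite addr0 ger0_norm // => /le_trans; apply.
have -> : b * L n - (b - v) * L (n + j%:Z) =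
    b * (L n - L (n + j%:Z)) + v * L (n + j%:Z) by ring.
rewrite mulrAC ler_wpM2r ?expR_ge0 // ler_wpM2l //.
apply: le_trans (ler_norm M); apply: HM; exists (n + j%:Z) => /=.
  (* The time [n + j] is both nonnegative and at least [n], hence admissible whether or not [B] is
     singular. *)
  by split=> //; right; rewrite lerDl.
by rewrite evol_natD.
Qed.

Lemma stable_manifold_sup n (x : 'cV[R]_d) :
  P n *m x = x -> stable_manifold B (n, x).
Proof.
move=> Px; have [_ [K [a [t [K0 a0 t0 at0 Hs]]]] _] := DP.
(* [S] covers the times [0 <= k < n], which occur for nonsingular [B]; from [n] on, the stable
   estimate gives the bound. *)
pose S := \sum_(i < `|n|) `|evol B i%:Z n *m x|.
have S0 : 0 <= S by rewrite sumr_ge0.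
exists (K * expR (t * `|L n|) * `|x| + S) => _ [k /= [k0 _] <-].
have [/int_geP[j ->]|kn] := leP n k.
  rewrite evol_natD -{1}Px; apply: le_trans (Hs n j x) _.
  rewrite -[leLHS]addr0 lerD // ler_wpM2r // ler_wpM2l // ler_expR addr0.
  rewrite gerDr; apply: mulr_le0_ge0; first exact: ltW.
  by rewrite subr_ge0 lograte_homo // lerDl.
have kn' : (`|k| < `|n|)%N by lia.
rewrite -[leLHS]add0r lerD ?mulr_ge0 ?expR_ge0 //.
rewrite /S (bigD1 (Ordinal kn')) //= gez0_abs // lerDl.
exact: sumr_ge0.
Qed.

Lemma stable_manifoldE : stable_manifold B = [set p | P p.1 *m p.2 = p.2].
Proof.
apply/seteqP; split=> -[n x] /=; first exact: stable_manifold_sub.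
exact: stable_manifold_sup.
Qed.

(** The bound is asked only where both [k <= n] and [k <= 0], so that the lemma serves both forms of
    the unstable manifold. Started at earlier and earlier times, the stable estimate makes
    [P n *m x n] arbitrarily small. *)
Lemma bounded_past_ker n (x : int -> 'cV[R]_d) (M : R) :
  (forall k, k < n -> x (k + 1) = B k *m x k) ->
  (forall k, k <= n -> k <= 0 -> `|x k| <= M) -> P n *m x n = 0.
Proof.
move=> xB xM; have [_ [K [a [t [K0 a0 t0 at0 Hs]]]] _] := DP.
apply/eqP; rewrite -normr_le0.
apply: (@le_expR_decay _ _ (K * `|M|) (a * L n) (- (a + t))).
- by rewrite mulr_ge0.
- lra.
move=> T; have [j j0 Tj] := lograte_ninfty hmu n (- T).
exists (- L (n - j%:Z)); first by lra.
have L0 : L (n - j%:Z) <= 0 by rewrite -(lograte0 hmu) lograte_homo.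
have <- : evol_fwd B (n - j%:Z) j *m x (n - j%:Z) = x n.
  by apply: evol_fwd_traj => k /andP[_ kn]; exact: xB.
rewrite mulmxA -[in P n](subrK j%:Z n) -(evol_fwd_comm BP) -mulmxA.
apply: le_trans (Hs _ _ _) _; rewrite addr0 subrK ler0_norm //.
have -> : a * L n - - (a + t) * - L (n - j%:Z) =
    a * (L n - L (n - j%:Z)) + t * - L (n - j%:Z) by ring.
rewrite [leRHS]mulrAC ler_wpM2l ?mulr_ge0 ?expR_ge0 //.
by apply: le_trans (ler_norm M); apply: xM => //; rewrite gerBl.
Qed.

Lemma ker_bounded_past n (y : 'cV[R]_d) : P n *m y = 0 ->
  exists (x : int -> 'cV[R]_d) (M : R),
    [/\ x n = y, forall k, k < n -> x (k + 1) = B k *m x k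
      & forall k, k <= n -> `|x k| <= M].
Proof.
move=> Py; have [_ _ [K [b [v [K0 b0 v0 bv0 Hu]]]]] := DP.
(* The pasts are chosen separately for each [k], with a default for [k > n]; injectivity on the
   kernels later shows that they form one solution. *)
have sol (k : int) : exists z : 'cV[R]_d, k <= n ->
    P k *m z = 0 /\ evol_fwd B k `|n - k|%N *m z = y.
  have [/int_geP[j nj]|nk] := leP k n; last by exists 0.
  have -> : `|n - k|%N = j by lia.
  have [|z Pz Ez] := evol_fwd_ker_surj BP (n := k) (j := j) (y := y).
    by rewrite -nj.
  by exists z.
have [x xP] := choice sol.
exists x, (K * expR (v * `|L n|) * `|y|); split.
- by have [//|_] := xP n; rewrite subrr /= mul1mx.
- move=> k kn; have [|Pk Ek] := xP k; first exact: ltW.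
  have [|Pk1 Ek1] := xP (k + 1); first by lia.
  apply: (@evol_fwd_ker_inj _ _ _ _ BP (k + 1) (absz (n - (k + 1))%R)) => //.
    by rewrite mulmxA -(invproj_comm BP) -mulmxA Pk mulmx0.
  rewrite Ek1 mulmxA -evol_fwdS.
  by have -> : (absz (n - (k + 1))%R).+1 = `|n - k|%N by lia.
- move=> k kn; have [//|Pk Ek] := xP k.
  have [j nj] := int_geP kn.
  have nkj : `|n - k|%N = j by lia.
  have := Hu k j y (x k) Pk; rewrite -nj -{1}nkj Ek kerP_compl // => /(_ erefl).
  move=> /le_trans; apply; rewrite ler_wpM2r // ler_wpM2l // ler_expR addr0.
  rewrite gerDr; apply: mulr_ge0_le0; first exact: ltW.
  by rewrite subr_le0 lograte_homo.
Qed.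

Lemma unstable_manifold_sub n (x : 'cV[R]_d) :
  unstable_manifold B (n, x) -> P n *m x = 0.
Proof.
case; have [nB /(_ nB) [M /= HM] _|sB _ /(_ sB)[y [/= <- yB [M HM]]]] :=
  pselect (nonsingular B).
  have evn : evol B n n = 1%:M by have := evol_natB B n 0; rewrite subr0.
  rewrite -[x]mul1mx -evn; apply: (@bounded_past_ker n (fun k => evol B k n *m
    x) M).
    move=> k kn; have [j nj] := int_geP (ltW kn).
    case: j nj => [|j] nj; first by lia.
    have -> : k + 1 = n - j%:Z by lia.
    have -> : k = n - j.+1%:Z by lia.
    by rewrite !evol_natB /= !mulmxA mulmxV // mul1mx.
  by move=> k _ k0; apply: HM; exists k.
by apply: (@bounded_past_ker n y M) => // k kn _; apply: HM; exists k.
Qed.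

Lemma unstable_manifold_sup n (y : 'cV[R]_d) :
  P n *m y = 0 -> unstable_manifold B (n, y).
Proof.
move=> /ker_bounded_past[x [M [xn xB xM]]]; split=> [nB|_] /=; last first.
  by exists x; split=> //; exists M => _ [k /= kn <-]; exact: xM.
(* [S] covers the times [n < k <= 0]; up to [n] the backward evolution coincides with the bounded
   past [x]. *)
pose S := \sum_(i < `|n|) `|evol B (- i%:Z) n *m y|.
have S0 : 0 <= S by rewrite sumr_ge0.
exists (`|M| + S) => _ [k /= k0 <-].
have [kn|nk] := leP k n.
  have [j nj] := int_geP kn.
  have -> : evol B k n *m y = x k.
    have -> : k = n - j%:Z by lia.
    rewrite evol_natB; apply: (can_inj (mulKmx (evol_fwd_unit (n - j%:Z) j
      nB))).
    rewrite mulmxA evol_fwd_bwd // mul1mx evol_fwd_traj // => i /andP[_ ni].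
    exact: xB.
  by rewrite -[leLHS]addr0 lerD // (le_trans (xM _ kn)) // ler_norm.
have kn' : (`|k| < `|n|)%N by lia.
rewrite -[leLHS]add0r lerD //.
rewrite /S (bigD1 (Ordinal kn')) //= (_ : - `|k|%:Z = k); last by lia.
by rewrite lerDl sumr_ge0.
Qed.

Lemma unstable_manifoldE : unstable_manifold B = [set p | P p.1 *m p.2 = 0].
Proof.
apply/seteqP; split=> -[n x] /=; first exact: unstable_manifold_sub.
exact: unstable_manifold_sup.
Qed.

End Manifolds.

(** * From an open set with a monotone rank to finitely many closed intervals *)

Section Gaps.
Variables (R : realType) (rho : set R) (r : R -> nat) (d : nat).
Hypotheses (d_gt0 : (0 < d)%N)
  (rho_open : forall g, rho g ->
     exists2 e, 0 < e & forall k, g - e <= k <= g + e -> rho k)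
  (r_le : forall g, rho g -> (r g <= d)%N)
  (r_homo : forall g h, g <= h -> rho g -> rho h -> (r g <= r h)%N)
  (r_gap : forall g h, g <= h -> rho g -> rho h -> r g = r h ->
     forall k, g <= k <= h -> rho k)
  (r_eq0 : forall g, rho g -> r g = 0%N -> forall h, h <= g -> rho h)
  (r_eqd : forall g, rho g -> r g = d -> forall h, g <= h -> rho h).

(* The value is 0 when [rho] has no point below [x], which is harmless since a
   gap of rank 0 is unbounded below: two points outside [rho] have the same
   value if and only if no point of [rho] separates them. *)
Definition rank_below (x : R) : nat :=
  (\max_(i < d.+1 | `[< exists g, [/\ rho g, (g < x)%R & r g = i] >]) i)%N.

Lemma rank_below_ge g x : rho g -> g < x -> (r g <= rank_below x)%N.
Proof.
move=> rg gx; have rd : (r g < d.+1)%N by rewrite ltnS r_le.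
rewrite /rank_below.
apply: (@leq_bigmax_cond _ _ (fun i : 'I_d.+1 => i : nat) (Ordinal rd)).
by apply/asboolP; exists g.
Qed.

Lemma rank_below_attained x : rank_below x = 0%N \/
  exists g, [/\ rho g, g < x & r g = rank_below x].
Proof.
rewrite /rank_below; elim/big_ind: _ => [|m n Hm Hn|i /asboolP];
  [by left| |by right].
by case: (leqP m n).
Qed.

Lemma rank_below_homo x y : x <= y -> (rank_below x <= rank_below y)%N.
Proof.
move=> xy; have [->//|[g [rg gx <-]]] := rank_below_attained x.
by rewrite rank_below_ge // (lt_le_trans gx).
Qed.

(** A gap of rank [d] extends to [+oo], so no point outside [rho] lies above it. This leaves [d]
    possible values, hence at most [d] intervals. *)
Lemma rank_below_lt_d x : ~ rho x -> (rank_below x < d)%N.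
Proof.
move=> rx; have [->//|[g [rg gx gE]]] := rank_below_attained x.
rewrite ltn_neqAle -gE r_le // andbT; apply/eqP => rd.
by apply: rx; apply: r_eqd rg rd _ _; exact: ltW.
Qed.

(** If the rank did not increase at [g], then [x] would lie in the gap of [g]: either that gap has
    rank 0 and is unbounded below, or it contains some [h < x] of the same rank. *)
Lemma rank_below_lt x g y : ~ rho x -> rho g -> x < g -> g < y ->
  (rank_below x < rank_below y)%N.
Proof.
move=> rx rg xg gy; apply: leq_trans (rank_below_ge rg gy).
have [->|[h [rh hx <-]]] := rank_below_attained x.
  by rewrite lt0n; apply/eqP => r0; apply: rx; apply: (r_eq0 rg r0); exact: ltW.
have hg : h <= g by apply/ltW/(lt_trans hx).
rewrite ltn_neqAle r_homo // andbT; apply/eqP => rhg.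
by apply: rx; apply: (r_gap hg rh rg rhg); rewrite !ltW.
Qed.

(** A point of [rho] realizing [rank_below y] cannot lie below [x], where it would count for
    [rank_below x] too. *)
Lemma rank_below_sep x y : ~ rho x -> ~ rho y ->
  (rank_below x < rank_below y)%N -> exists2 g, rho g & x < g < y.
Proof.
move=> rx ry cxy.
have xy : x < y.
  by rewrite ltNge; apply/negP => /rank_below_homo; rewrite leqNgt cxy.
have [c0|[g [rg gy gE]]] := rank_below_attained y; first by rewrite c0 in cxy.
exists g => //; rewrite gy andbT ltNge; apply/negP.
rewrite le_eqVlt => /orP[/eqP gx|gx]; first by apply: rx; rewrite -gx.
by have := rank_below_ge rg gx; rewrite gE leqNgt cxy.
Qed.

Definition rank_class (j : nat) : set R := [set x | ~ rho x /\ rank_below x =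
    j].

Lemma rank_class_between j x y k :
  rank_class j x -> rank_class j y -> x <= k <= y -> ~ rho k.
Proof.
move=> [rx xj] [ry yj] /andP[xk ky] rk.
have xk' : x < k by rewrite lt_neqAle xk andbT; apply/eqP => E; apply: rx;
  rewrite E.
have ky' : k < y by rewrite lt_neqAle ky andbT; apply/eqP => E; apply: ry;
  rewrite -E.
by have := rank_below_lt rx rk xk' ky'; rewrite xj yj ltnn.
Qed.

(** For an empty class the endpoints are [+oo] and [-oo]; only nonempty classes are retained as
    spectral intervals. *)
Let a j : \bar R := ereal_inf (EFin @` rank_class j).
Let b j : \bar R := ereal_sup (EFin @` rank_class j).

(** The supremum is attained because [rho] is open: if [x] were in [rho], a class point just below
    [x] would be in [rho] as well, and one above [x] would be separated from [y] by [x]. *)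
Lemma rank_class_sup j y x :
  rank_class j y -> y <= x -> (x%:E <= b j)%E -> rank_class j x.
Proof.
move=> Cy yx xb.
have above u : u < x -> exists2 z, rank_class j z & u < z.
  move=> ux; have : (u%:E < b j)%E by apply: lt_le_trans xb; rewrite lte_fin.
  by move=> /ereal_sup_gt[_ [z Cz <-]]; rewrite lte_fin; exists z.
have rx : ~ rho x.
  move=> rx; have [e e0 He] := rho_open rx.
  have [|z Cz xz] := above (x - e); first by lra.
  have [zx|zx] := leP z x.
    by case: Cz => + _; apply; apply: He; apply/andP; split; lra.
  by apply: (rank_class_between Cy Cz (k := x)) => //; rewrite yx ltW.
split=> //; case: (Cy) => ry yj; apply/eqP; rewrite eqn_leq -{2}yj.
rewrite rank_below_homo // andbT leqNgt; apply/negP => jc.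
have [|g rg /andP[yg gx]] := rank_below_sep ry rx; first by rewrite yj.
have [z Cz gz] := above g gx.
by apply: (rank_class_between Cy Cz (k := g)) => //; rewrite !ltW.
Qed.

Lemma rank_class_inf j y x :
  rank_class j y -> x <= y -> (a j <= x%:E)%E -> rank_class j x.
Proof.
move=> Cy xy ax.
have below u : x < u -> exists2 z, rank_class j z & z < u.
  move=> xu; have : (a j < u%:E)%E by apply: le_lt_trans ax _; rewrite lte_fin.
  by move=> /ereal_inf_lt[_ [z Cz <-]]; rewrite lte_fin; exists z.
have rx : ~ rho x.
  move=> rx; have [e e0 He] := rho_open rx.
  have [|z Cz xz] := below (x + e); first by lra.
  have [xz'|zx] := leP x z.
    by case: Cz => + _; apply; apply: He; apply/andP; split; lra.
  by apply: (rank_class_between Cz Cy (k := x)) => //; rewrite xy ltW.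
split=> //; case: (Cy) => ry yj; apply/eqP; rewrite eqn_leq -{1}yj.
rewrite rank_below_homo //= leqNgt; apply/negP => jc.
have [|g rg /andP[xg gy]] := rank_below_sep rx ry; first by rewrite yj.
have [z Cz gz] := below g xg.
by apply: (rank_class_between Cz Cy (k := g)) => //; rewrite !ltW.
Qed.

Lemma rank_class_ext_itv j :
  rank_class j !=set0 -> rank_class j = ext_itv (a j) (b j).
Proof.
move=> [y Cy]; apply/seteqP; split=> x /=.
  move=> Cx; apply/andP; split;
    first exact: (ereal_inf_lbound (imageP EFin Cx)).
  exact: (ereal_sup_ubound (imageP EFin Cx)).
case/andP=> ax xb; have [yx|xy] := leP y x;
  first exact: rank_class_sup Cy yx xb.
exact: rank_class_inf Cy (ltW xy) ax.
Qed.

(** [rho] contains an interval around a separating point [g], so class [i] stays below [g - e] and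
    class [j] above [g]; hence the strict inequality. *)
Lemma rank_class_lt i j : rank_class i !=set0 -> rank_class j !=set0 ->
  (i < j)%N -> (b i < a j)%E.
Proof.
move=> [x Cx] [y Cy] ij; have [[rx xi] [ry yj]] := (Cx, Cy).
have [|g rg /andP[xg gy]] := rank_below_sep rx ry; first by rewrite xi yj.
have [e e0 He] := rho_open rg.
apply: (@le_lt_trans _ _ (g - e)%:E).
  apply: ge_ereal_sup => _ [z Cz <-]; rewrite lee_fin leNgt; apply/negP => gz.
  have [zg|zg] := leP z g.
    by case: Cz => + _; apply; apply: He; apply/andP; split; lra.
  by apply: (rank_class_between Cx Cz (k := g)) => //; rewrite !ltW.
apply: (@lt_le_trans _ _ g%:E); first by rewrite lte_fin; lra.
apply: le_ereal_inf_tmp => _ [z Cz <-]; rewrite lee_fin leNgt; apply/negP => zg.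
by apply: (rank_class_between Cz Cy (k := g)) => //; rewrite !ltW.
Qed.

Lemma gaps_compl : exists (m : nat) (a b : nat -> \bar R),
  [/\ (m <= d)%N,
      ~` rho = \bigcup_(i in [set i : nat | (1 <= i <= m)%N]) ext_itv (a i) (b
        i),
      forall i : nat, (1 <= i <= m)%N ->
        [/\ (a i <= b i)%E, a i != +oo%E & b i != -oo%E]
    & forall i : nat, (1 <= i < m)%N -> (b i < a i.+1)%E].
Proof.
(* [s] lists in increasing order the values with a nonempty class; the intervals are numbered from
   1, hence the [i.-1] below. *)
pose s := [seq j <- iota 0 d | `[< rank_class j !=set0 >]].
have sC i : (1 <= i <= size s)%N -> rank_class (nth 0%N s i.-1) !=set0.
  case: i => // i /= /(mem_nth 0%N).
  by rewrite mem_filter => /andP[/asboolP].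
exists (size s), (fun i => a (nth 0%N s i.-1)), (fun i => b (nth 0%N s i.-1)).
split.
- by rewrite size_filter (leq_trans (count_size _ _)) // size_iota.
- apply/seteqP; split=> x.
    move=> rx; pose j := rank_below x.
    have Cx : rank_class j x by split.
    have js : j \in s.
      rewrite mem_filter mem_iota /= add0n rank_below_lt_d // andbT.
      by apply/asboolP; exists x.
    exists (index j s).+1; first by rewrite /= index_mem.
    by rewrite /= nth_index // -rank_class_ext_itv //; exists x.
  by move=> [i /= /sC Ci]; rewrite -rank_class_ext_itv // => -[].
- move=> i /sC[x Cx].
  have ax : (a (nth 0%N s i.-1) <= x%:E)%E by exact: (ereal_inf_lbound (imageP
    EFin Cx)).
  have xb : (x%:E <= b (nth 0%N s i.-1))%E by exact: (ereal_sup_ubound (imageP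
    EFin Cx)).
  split; first exact: le_trans xb.
    by apply/eqP => E; move: ax; rewrite E.
  by apply/eqP => E; move: xb; rewrite E.
- case=> // i im; apply: rank_class_lt; [apply: sC|apply: sC|].
  + by rewrite /= ltnW.
  + exact: im.
  + apply: (sorted_ltn_nth ltn_trans) => //.
    * by apply: sorted_filter; [exact: ltn_trans|exact: iota_ltn_sorted].
    * by rewrite inE ltnW.
Qed.

End Gaps.

(** * Spectral gaps as intervals *)

Section SameGap.
Variables (R : realType) (d : nat) (mu : int -> R) (A : int -> 'M[R]_d).

Lemma same_gap_sym z g : same_gap mu A z g -> same_gap mu A g z.
Proof. by case=> G [? ? ?]; exists G. Qed.

Lemma same_gapP z g : z <= g -> resolvent mu A z ->
  same_gap mu A z g <-> forall k, z <= k <= g -> resolvent mu A k.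
Proof.
move=> zg rz; split=> [[G [[x rx ->] Gz Gg]] k zkg|H].
  apply: (@connected_component_sub _ _ x).
  have /connected_intervalP itv :
    connected (connected_component (resolvent mu A) x).
    exact: component_connected.
  exact: itv Gz Gg k zkg.
exists (connected_component (resolvent mu A) z); split; first by exists z.
  exact: connected_component_refl.
apply: (@connected_component_max _ _ [set k | z <= k <= g]).
- by rewrite /= lexx.
- exact: H.
- apply/connected_intervalP => u v /= /andP[zu _] /andP[_ vg] w /andP[uw wv].
  by rewrite (le_trans zu uw) (le_trans wv vg).
- by rewrite /= lexx andbT.
Qed.

End SameGap.

(** * Consequences of nonuniform growth *)

Section Growth.
Variables (R : realType) (d : nat) (mu : int -> R) (A : int -> 'M[R]_d).
Hypotheses (hmu : growth_rate mu) (nA : nonsingular A).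
Local Notation L := (lograte mu).

Lemma invariant_projector1 : invariant_projector A (fun=> 1%:M).
Proof.
split=> n; first by rewrite mulmx1.
  by rewrite mulmx1 mul1mx.
split=> [x|x y|x]; rewrite /kerP /= ?inE /=.
- by rewrite !mul1mx => ->; rewrite mulmx0.
- by rewrite !mul1mx => -> ->.
- by rewrite mul1mx => ->; exists 0; rewrite /= mulmx0.
Qed.

Lemma invariant_projector0 : invariant_projector A (fun=> 0).
Proof.
split=> n; first by rewrite mulmx0.
  by rewrite mulmx0 mul0mx.
split=> [x _|x y _ _|x _]; rewrite /kerP /=; first by rewrite mul0mx.
  exact: (can_inj (mulKmx (nA n))).
by exists (invmx (A n) *m x); rewrite /= ?mul0mx // mulKVmx.
Qed.

Variables (K e c : R).
Hypotheses (K_ge1 : 1 <= K) (c_ge0 : 0 <= c) (e_gt0 : 0 < e)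
  (growth : forall k n : int, opnorm (mulmx (evol A k n))
     <= K * (mu k / mu n) `^ ((sgz (k - n))%:~R * c)
          * mu n `^ ((sgz n)%:~R * e)).

Let K_ge0 : 0 <= K. Proof. exact: le_trans ler01 K_ge1. Qed.

Lemma evol_growth k n (x : 'cV[R]_d) : `|evol A k n *m x|
  <= K * expR ((sgz (k - n))%:~R * c * (L k - L n) + e * `|L n|) * `|x|.
Proof.
have C0 : 0 <= K * expR ((sgz (k - n))%:~R * c * (L k - L n) + e * `|L n|).
  by apply: mulr_ge0; [exact: K_ge0|exact: expR_ge0].
move: x; apply/(opnorm_leP C0 (f := mulmx (evol A k n))) => //.
by rewrite expRD mulrA -(ratio_powR hmu) -(sgz_powR hmu) growth.
Qed.

Lemma growth_dich1 g : c + e < g -> dich_proj L A (fun=> 1%:M) g.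
Proof.
have [[K0 e0] c0] := (K_ge0, e_gt0, c_ge0).
move=> ceg; split; first exact: invariant_projector1.
  (* With [alpha = c - g], the exponent [alpha + g] is that of the growth bound, and
     [alpha + theta < 0] is the hypothesis on [g]. *)
  exists K, (c - g), e; split=> [||||n j x]; try by lra.
  rewrite /= mul1mx -evol_natD subrK; apply: le_trans (evol_growth _ _ _) _.
  rewrite ler_wpM2r // ler_wpM2l // ler_expR.
  (* For [j = 0] the sign in the growth bound is 0 instead of 1, but the difference of [L] vanishes
     too. *)
  rewrite lerD2r; case: j => [|j]; first by rewrite addr0 !subrr !mulr0.
  by rewrite [n + _]addrC addrK gtr0_sgz // mul1r.
exists 0, 1, 0; split=> [||||n j x y]; try by lra.
by rewrite /= mul1mx => -> _; rewrite normr0 !mul0r.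
Qed.

Lemma growth_dich0 g : g < - (c + e) -> dich_proj L A (fun=> 0) g.
Proof.
have [[K0 e0] c0] := (K_ge0, e_gt0, c_ge0).
move=> gce; split; first exact: invariant_projector0.
  exists 0, (-1), 0; split=> [||||n j x]; try by lra.
  by rewrite /= mul0mx mulmx0 normr0 !mul0r.
(* Here [beta + g = - c], in accordance with the sign [-1] of a backward time. *)
exists K, (- c - g), e; split=> [||||n j x y _]; try by lra.
rewrite /= subr0 mul1mx => Ey.
have -> : y = evol A n (n + j%:Z) *m x.
  apply: (can_inj (mulKmx (evol_fwd_unit n j nA))); rewrite Ey mulmxA.
  have := evol_natB A (n + j%:Z) j; rewrite addrK => ->.
  by have := evol_fwd_bwd (n + j%:Z) j nA; rewrite addrK => ->; rewrite mul1mx.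
apply: le_trans (evol_growth _ _ _) _.
rewrite ler_wpM2r // ler_wpM2l // ler_expR.
rewrite lerD2r subrK; case: j {Ey} => [|j].
  by rewrite addr0 !subrr !mulr0.
by rewrite opprD addrA subrr add0r sgzN gtr0_sgz // mulN1r.
Qed.

End Growth.

(** * Structure of the spectrum *)

Section Spectrum.
Variables (R : realType) (d : nat) (mu : int -> R) (A : int -> 'M[R]_d).
Hypothesis hmu : growth_rate mu.
Local Notation L := (lograte mu).

Lemma resolventP g : resolvent mu A g <-> exists P, dich_proj L A P g.
Proof. by split=> -[P DP]; exists P; apply/(NmuD_weighted hmu A P g). Qed.

Lemma dich_proj_same_gapP z g P Q : z <= g ->
  dich_proj L A P z -> dich_proj L A Q g -> P = Q <-> same_gap mu A z g.
Proof.
move=> zg DP DQ; have rz : resolvent mu A z by apply/resolventP; exists P.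
split=> [PQ|/(same_gapP zg rz) H].
  apply/(same_gapP zg rz) => k zkg; apply/resolventP; exists P.
  by apply: (dich_proj_between hmu zkg DP); rewrite PQ.
by apply: (dich_proj_interval hmu zg DP DQ) => k /H /resolventP.
Qed.

Lemma spectrum_ext_itv : (0 < d)%N -> exists (m : nat) (a b : nat -> \bar R),
  [/\ (m <= d)%N,
      spectrum mu A
        = \bigcup_(i in [set i : nat | (1 <= i <= m)%N]) ext_itv (a i) (b i),
      forall i : nat, (1 <= i <= m)%N ->
        [/\ (a i <= b i)%E, a i != +oo%E & b i != -oo%E]
    & forall i : nat, (1 <= i < m)%N -> (b i < a i.+1)%E].
Proof.
move=> d0.
(* Uniqueness of the projector makes its rank a function of [g], with value 0 outside the
   resolvent. *)
have rk g : exists k, forall P, dich_proj L A P g -> \rank (P 0) = k.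
  have [[P DP]|nP] := pselect (exists P, dich_proj L A P g).
    by exists (\rank (P 0)) => Q DQ; rewrite (dich_proj_uniq hmu DQ DP).
  by exists 0%N => P DP; case: nP; exists P.
have [r rP] := choice rk.
apply: (@gaps_compl _ (resolvent mu A) r d d0).
- move=> g /resolventP[P /dich_proj_open] => /(_ hmu) [e e0 H].
  by exists e => // k /H Dk; apply/resolventP; exists P.
- by move=> g /resolventP[P /rP <-]; exact: rank_leq_row.
- move=> g h gh /resolventP[P DP] /resolventP[Q DQ].
  by rewrite -(rP _ _ DP) -(rP _ _ DQ) (dich_proj_rank_le hmu gh DP DQ).
- move=> g h gh /resolventP[P DP] /resolventP[Q DQ].
  rewrite -(rP _ _ DP) -(rP _ _ DQ) => /(dich_proj_rank_eq hmu gh DP DQ) PQ.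
  move=> k gkh; apply/resolventP; exists P.
  by apply: (dich_proj_between hmu gkh DP); rewrite PQ.
- move=> g /resolventP[P DP]; rewrite -(rP _ _ DP) => P0 h hg.
  by apply/resolventP; exists P; exact: dich_proj_rank0 DP P0.
- move=> g /resolventP[P DP]; rewrite -(rP _ _ DP) => Pd h gh.
  by apply/resolventP; exists P; exact: dich_proj_rank_full DP Pd.
Qed.

(** In terms of ranges and kernels the inclusions amount to [P Q = Q P = P]; a reverse inclusion
    would give [P = Q], hence the same gap. *)
Lemma manifolds_proper z g : resolvent mu A z -> resolvent mu A g ->
  ~ same_gap mu A z g -> g < z ->
  unstable_manifold (weighted mu A z) `<` unstable_manifold (weighted mu A g)
  /\ stable_manifold (weighted mu A g) `<` stable_manifold (weighted mu A z).
Proof.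
move=> /resolventP[Q DQ] /resolventP[P DP] nzg gz.
have weight S k : dich_proj L A S k -> dich_proj L (weighted mu A k) S 0.
  by move=> DS; apply/(dich_proj_weighted hmu); rewrite addr0.
have PQ : P <> Q.
  by move/(dich_proj_same_gapP (ltW gz) DP DQ)/same_gap_sym.
have le_PQ := dich_proj_le hmu (ltW gz) DP DQ.
have [AP _ _] := DP; have [AQ _ _] := DQ.
rewrite !(unstable_manifoldE hmu (weight _ _ DP)).
rewrite !(unstable_manifoldE hmu (weight _ _ DQ)).
rewrite !(stable_manifoldE hmu (weight _ _ DP)).
rewrite !(stable_manifoldE hmu (weight _ _ DQ)).
split; split=> [[n x] /= H|sub].
- by have [_ <-] := le_PQ n; rewrite -mulmxA H mulmx0.
(* Kernels included the other way give [Q (1 - P) = 0], so [Q = Q P = P]. *)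
- apply: PQ; apply/funext => n; have [<- _] := le_PQ n.
  apply/esym/mulmx_colP => x.
  have /= := sub (n, (1%:M - P n) *m x) (invproj_compl AP n x).
  by rewrite mulmxA mulmxBr mulmx1 mulmxBl => /subr0_eq.
- by have [+ _] := le_PQ n; rewrite -H mulmxA => ->.
- apply: PQ; apply/funext => n; have [_ <-] := le_PQ n.
  apply/mulmx_colP => x; rewrite -mulmxA.
  apply: (sub (n, Q n *m x)).
  by rewrite /= mulmxA (invproj_idem AQ).
Qed.

(** The projector is [Id] above [c + e] and [0] below [- (c + e)]. Were the spectrum empty, both
    would belong to one gap and coincide, against [d > 0]. *)
Lemma growth_spectrum e : (0 < d)%N -> 0 < e -> Nmu_growth mu e A ->
  exists2 N : R, (forall x, spectrum mu A x -> `|x| <= N) &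
    spectrum mu A !=set0.
Proof.
move=> d0 e0 [nA [K [c [K1 c0 growth]]]].
have D1 g : c + e < g -> dich_proj L A (fun=> 1%:M) g.
  exact: (growth_dich1 hmu K1 c0 e0 growth).
have D0 g : g < - (c + e) -> dich_proj L A (fun=> 0) g.
  exact: (growth_dich0 hmu nA K1 c0 e0 growth).
exists (c + e).
  move=> x rx; rewrite ler_norml; apply/andP.
  split; rewrite leNgt; apply/negP => cx; apply: rx; apply/resolventP.
    by exists (fun=> 0); exact: D0.
  by exists (fun=> 1%:M); exact: D1.
apply/set0P/eqP => S0.
have res k : exists P, dich_proj L A P k.
  apply/resolventP; apply: contrapT => nk.
  by have : spectrum mu A k by []; rewrite S0.
have DP : dich_proj L A (fun=> 0) (- (c + e) - 1) by apply: D0; lra.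
have DQ : dich_proj L A (fun=> 1%:M) (c + e + 1) by apply: D1; lra.
have /(congr1 (fun P => \rank (P 0))) : (fun=> 0) = (fun=> 1%:M) :> (int ->
  'M[R]_d).
  by apply: (dich_proj_interval hmu _ DP DQ) => [|k _]; [lra|exact: res].
by rewrite mxrank0 mxrank1 => d0'; rewrite -d0' in d0.
Qed.

End Spectrum.

(** * Finite endpoints and assembly of the results *)

Lemma ext_itv_bounded (R : realType) (a b : \bar R) (N : R) :
  (a <= b)%E -> a != +oo%E -> b != -oo%E ->
  (forall x, ext_itv a b x -> `|x| <= N) -> a != -oo%E /\ b != +oo%E.
Proof.
move=> ab ay bny H.
split; apply/eqP => E; rewrite E in H ab.
(* An interval unbounded below contains a point less than [- N], taken below [b] when [b] is
   finite. *)
- case: b ab bny H => [s| |] // _ _ H.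
    have : `|Num.min s (- N - 1)| <= N.
      by apply: H; rewrite /ext_itv /= leNye lee_fin ge_min lexx.
    rewrite ler_norml => /andP[+ _]; rewrite le_min => /andP[_]; lra.
  have : `|- N - 1| <= N by apply: H; rewrite /ext_itv /= leNye leey.
  by rewrite ler_norml => /andP[+ _]; lra.
- case: a ab ay H => [s| |] // _ _ H.
    have : `|Num.max s (N + 1)| <= N.
      by apply: H; rewrite /ext_itv /= leey andbT lee_fin le_max lexx.
    rewrite ler_norml => /andP[_]; rewrite ge_max => /andP[_]; lra.
  have : `|N + 1| <= N by apply: H; rewrite /ext_itv /= leNye leey.
  by rewrite ler_norml => /andP[_]; lra.
Qed.

Theorem theorem3p10 (R : realType) (d : nat) (hd : (1 <= d)%N)
    (mu : int -> R) (hmu : growth_rate mu) (A : int -> 'M[R]_d) :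
  exists (m : nat) (a b : nat -> \bar R),
    [/\ (m <= d)%N,
        spectrum mu A
          = \bigcup_(i in [set i : nat | (1 <= i <= m)%N]) ext_itv (a i) (b i),
        forall i : nat, (1 <= i <= m)%N ->
          [/\ (a i <= b i)%E, a i != +oo%E & b i != -oo%E]
      & forall i : nat, (1 <= i < m)%N -> (b i < a i.+1)%E]
    /\
    [/\
        forall gamma : R, resolvent mu A gamma ->
          exists! P : int -> 'M[R]_d, NmuD mu (weighted mu A gamma) P,
        forall (zeta gamma : R) (P Q : int -> 'M[R]_d),
          resolvent mu A zeta -> resolvent mu A gamma ->
          NmuD mu (weighted mu A zeta) P -> NmuD mu (weighted mu A gamma) Q ->
          (P = Q <-> same_gap mu A zeta gamma),
        forall zeta gamma : R,
          resolvent mu A zeta -> resolvent mu A gamma ->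
          ~ same_gap mu A zeta gamma -> gamma < zeta ->
          unstable_manifold (weighted mu A zeta)
            `<` unstable_manifold (weighted mu A gamma)
          /\ stable_manifold (weighted mu A gamma)
               `<` stable_manifold (weighted mu A zeta)
      &
        forall eps : R, 0 < eps -> Nmu_growth mu eps A ->
          [/\ spectrum mu A !=set0, bounded_set (spectrum mu A : set R),
              m != 0%N, a 1%N != -oo%E & b m != +oo%E]].
Proof.
have [m [a [b [md SE ab lt_ba]]]] := spectrum_ext_itv A hmu hd.
exists m, a, b; split; first by split.
split.
- move=> g [P DP]; exists P; split=> // Q /(NmuD_weighted hmu) DQ.
  by move: DP => /(NmuD_weighted hmu) DP; exact: (dich_proj_uniq hmu DP DQ).
- move=> z g P Q _ _ /(NmuD_weighted hmu) DP /(NmuD_weighted hmu) DQ.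
  (* The criterion is stated for ordered points; the other order follows by symmetry of both
     sides. *)
  have [zg|/ltW gz] := leP z g; first exact: dich_proj_same_gapP.
  split=> [PQ|/same_gap_sym].
    by apply: same_gap_sym; apply/(dich_proj_same_gapP hmu gz DQ DP).
  by move/(dich_proj_same_gapP hmu gz DQ DP).
- by move=> z g; exact: manifolds_proper.
- move=> e e0 growth; have [N SN S0] := growth_spectrum hmu hd e0 growth.
  have m0 : m != 0%N.
    by case: S0 => x; rewrite SE => -[i /= im _]; lia.
  (* Each interval lies in the spectrum, so the bound [N] excludes infinite endpoints. *)
  have bnd i : (1 <= i <= m)%N -> a i != -oo%E /\ b i != +oo%E.
    move=> im; have [? ? ?] := ab i im.
    apply: (ext_itv_bounded (N := N)) => // x xi; apply: SN; rewrite SE.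
    by exists i.
  split=> //.
  + exists N; split; first exact: num_real.
    by move=> M NM x /SN xN; exact: le_trans xN (ltW NM).
  + by apply: (bnd _ _).1; lia.
  + by apply: (bnd _ _).2; lia.
Qed.
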